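(* Let $(u^j,p^j;\lambda^j)$, $j\ge0$, be the iterates of the Generalized ADMM (defined in the context). For all $j\ge 1$, if $\tau_{j+1}\le\tau_j$, then $$2\tau_{j+1}\bigl(\widehat{\varrho}_F(p^j,p^{j+1})+\widehat{\varrho}_G(u^j,u^{j+1})\bigr)+R_{j+1}^2\le R_j^2 .$$ In particular, the residual is non-increasing, i.e. $R_{j+1}\le R_j$.
   Context: $X,Y$ are real Hilbert spaces with inner products $(\cdot,\cdot)_X,(\cdot,\cdot)_Y$, identified with their duals. $F:Y\to\mathbb{R}\cup\{+\infty\}$ and $G:X\to\mathbb{R}\cup\{+\infty\}$ are convex, proper and lower semicontinuous, and $B:X\to Y$ is a bounded linear operator such that $u\mapsto F(Bu)+G(u)$ is proper and coercive. For $\tau>0$, $$\mathcal{L}_\tau(u,p;\lambda)=F(p)+G(u)+(\lambda,Bu-p)_Y+\frac{\tau}{2}\|Bu-p\|_Y^2 ,$$ and $(u,p;\lambda)\in X\times Y\times Y$ is a saddle point of $\mathcal{L}_\tau$ if $\mathcal{L}_\tau(u,p;\mu)\le\mathcal{L}_\tau(u,p;\lambda)\le\mathcal{L}_\tau(v,q;\lambda)$ for all $(v,q,\mu)\in X\times Y\times Y$. It is assumed that a saddle point exists. Coercivity functionals: $\varrho_F:Y\times Y\to\mathbb{R}$ and $\varrho_G:X\times X\to\mathbb{R}$ are nonnegative functionals describing possible strong convexity of $F$ and $G$: whenever $\mu\in\partial F(p)$, $(\mu,q-p)_Y+F(p)+\varrho_F(q,p)\le F(q)$ for all $q\in Y$;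 whenever $\xi\in\partial G(u)$, $(\xi,v-u)_X+G(u)+\varrho_G(v,u)\le G(v)$ for all $v\in X$. Their symmetrizations are $\widehat{\varrho}_G(u,u')=\varrho_G(u,u')+\varrho_G(u',u)$ and $\widehat{\varrho}_F(p,p')=\varrho_F(p,p')+\varrho_F(p',p)$. Generalized ADMM: choose $(u^0,\lambda^0)\in X\times Y$ with $G(u^0)<\infty$, $\overline{\tau}\ge\underline{\tau}>0$, and set $\tau_1=\overline{\tau}$. For $j=1,2,\dots$: compute a minimizer $p^j\in Y$ of $p\mapsto\mathcal{L}_{\tau_j}(u^{j-1},p;\lambda^{j-1})$; compute a minimizer $u^j\in X$ of $u\mapsto\mathcal{L}_{\tau_j}(u,p^j;\lambda^{j-1})$ (minimizers are assumed to exist); set $\lambda^j=\lambda^{j-1}+\tau_j(Bu^j-p^j)$; define the residual $R_j=\bigl(\|\lambda^j-\lambda^{j-1}\|_Y^2+\tau_j^2\|B(u^j-u^{j-1})\|_Y^2\bigr)^{1/2}$; choose $\tau_{j+1}\in[\underline{\tau},\overline{\tau}]$. The iterates are regarded as an infinite sequence (the stopping test is ignored). *)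

(* Defs.v *)
From HB Require Import structures.
From mathcomp Require Import all_boot all_order all_algebra.
From mathcomp Require Import sesquilinear.
From mathcomp Require Import all_classical all_reals topology normedtype.

Set Implicit Arguments.
Unset Strict Implicit.
Unset Printing Implicit Defensive.

Import Order.TTheory GRing.Theory Num.Theory numFieldNormedType.Exports.

Local Open Scope classical_set_scope.
Local Open Scope ring_scope.

(* A real Hilbert space is rendered as a [completeNormedModType R] together
   with a (symmetric, since theta is [idfun]) positive definite form whose
   associated norm is the norm of the space. *)
Definition induces_norm (R : realType) (V : normedModType R)
    (dot : {dot V for idfun}) : Prop :=
  forall x : V, `|x| ^+ 2 = dot x x.

(* Functions V -> R \cup {+oo} are maps to [\bar R] that never take the value
   -oo; this is part of [proper_fun]. With it, the sum in
   [convex_efun] is never of the form +oo - oo, and 0 * +oo = 0 makes the cases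
   t = 0 and t = 1 harmless. *)
Definition proper_fun (R : realType) (V : Type) (f : V -> \bar R) : Prop :=
  (forall x, f x <> -oo%E) /\ (exists x, (f x < +oo)%E).

Definition convex_efun (R : realType) (V : lmodType R) (f : V -> \bar R) :
    Prop :=
  forall (x y : V) (t : R), 0 <= t <= 1 ->
    (f (t *: x + (1 - t) *: y)%R <= t%:E * f x + (1 - t)%:E * f y)%E.

Definition coercive_fun (R : realType) (V : normedModType R)
    (f : V -> \bar R) : Prop :=
  forall M : R, \forall r \near +oo,
    forall x : V, r <= `|x| -> (M%:E <= f x)%E.

Definition is_minimizer (R : realType) (V : Type) (f : V -> \bar R) (x : V) :
    Prop :=
  forall y : V, (f x <= f y)%E.

(* The subdifferential is a subset of V, the dual being identified with V
   through [dot]. It is empty where a proper f takes the value +oo. *)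
Definition subdifferential (R : realType) (V : normedModType R)
    (dot : {dot V for idfun}) (f : V -> \bar R) (x : V) : set V :=
  [set s | forall y : V, ((dot s (y - x)%R)%:E + f x <= f y)%E].

Definition coercivity_functional (R : realType) (V : normedModType R)
    (dot : {dot V for idfun}) (f : V -> \bar R) (rho : V -> V -> R) : Prop :=
  (forall y x : V, 0 <= rho y x) /\
  (forall x s : V, subdifferential dot f x s ->
     forall y : V, ((dot s (y - x)%R)%:E + f x + (rho y x)%:E <= f y)%E).

Definition symmetrization (R : realType) (V : Type) (rho : V -> V -> R)
    (x y : V) : R :=
  rho x y + rho y x.

Definition aug_lagrangian (R : realType) (X Y : normedModType R)
    (dotY : {dot Y for idfun}) (F : Y -> \bar R) (G : X -> \bar R)
    (B : X -> Y) (tau : R) (u : X) (p : Y) (lambda : Y) : \bar R :=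
  (F p + G u + (dotY lambda (B u - p)%R)%:E
    + (tau / 2 * `|B u - p| ^+ 2)%R%:E)%E.

Definition saddle_point (R : realType) (X Y : normedModType R)
    (dotY : {dot Y for idfun}) (F : Y -> \bar R) (G : X -> \bar R)
    (B : X -> Y) (tau : R) (u : X) (p : Y) (lambda : Y) : Prop :=
  let L := aug_lagrangian dotY F G B tau in
  forall (v : X) (q mu : Y),
    (L u p mu <= L u p lambda)%E /\ (L u p lambda <= L v q lambda)%E.

(* The values p 0 and tau 0 play no role. *)
Record generalized_admm (R : realType) (X Y : normedModType R)
    (dotY : {dot Y for idfun}) (F : Y -> \bar R) (G : X -> \bar R)
    (B : X -> Y) (tau_low tau_up : R) (u : nat -> X) (p lambda : nat -> Y)
    (tau : nat -> R) : Prop := GeneralizedADMM {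
  admm_init : (G (u 0%N) < +oo)%E ;
  admm_low_gt0 : 0 < tau_low ;
  admm_low_up : tau_low <= tau_up ;
  admm_tau1 : tau 1%N = tau_up ;
  admm_p : forall j : nat, (1 <= j)%N ->
    is_minimizer
      (fun q : Y =>
         aug_lagrangian dotY F G B (tau j) (u j.-1) q (lambda j.-1)) (p j) ;
  admm_u : forall j : nat, (1 <= j)%N ->
    is_minimizer
      (fun v : X =>
         aug_lagrangian dotY F G B (tau j) v (p j) (lambda j.-1)) (u j) ;
  admm_lambda : forall j : nat, (1 <= j)%N ->
    lambda j = lambda j.-1 + tau j *: (B (u j) - p j) ;
  admm_tau : forall j : nat, (1 <= j)%N -> tau_low <= tau j.+1 <= tau_up
}.

Definition residual (R : realType) (X Y : normedModType R) (B : X -> Y)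
    (u : nat -> X) (lambda : nat -> Y) (tau : nat -> R) (j : nat) : R :=
  Num.sqrt (`|lambda j - lambda j.-1| ^+ 2
            + tau j ^+ 2 * `|B (u j - u j.-1)| ^+ 2).

(* Main.v *)
(* The optimality conditions of the two subproblems say that
   [lambda_j - tau_j B (u_j - u_(j-1))] is a subgradient of F at p_j and
   [- B^* lambda_j] one of G at u_j; the adjoint comes from Riesz
   representation. Strong monotonicity of the subdifferentials at steps j and
   j+1, with [p_j = B u_j - (lambda_j - lambda_(j-1)) / tau_j] eliminated,
   reduces the claim to a quadratic inequality between increments, whose defect
   is a sum of squares when [tau_(j+1) <= tau_j]. *)
Require Import Defs.
From HB Require Import structures.
From mathcomp Require Import all_boot all_order all_algebra.
From mathcomp Require Import sesquilinear.
From mathcomp Require Import all_classical all_reals topology normedtype.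
From mathcomp Require Import ring lra.

Set Implicit Arguments.
Unset Strict Implicit.
Unset Printing Implicit Defensive.

Import Order.TTheory GRing.Theory Num.Theory numFieldNormedType.Exports.

Local Open Scope classical_set_scope.
Local Open Scope ring_scope.

(** * Hilbert space geometry, first-order optimality and Riesz representation *)

Lemma dotC (R : realType) (V : normedModType R) (dot : {dot V for idfun})
    (x y : V) : dot x y = dot y x.
Proof. by rewrite hermC /= expr0 mul1r. Qed.

Lemma sqr_normD (R : realType) (V : normedModType R) (dot : {dot V for idfun})
    (hV : induces_norm dot) (x y : V) :
  `|x + y| ^+ 2 = `|x| ^+ 2 + 2 * dot x y + `|y| ^+ 2.
Proof. rewrite !hV linearDr /= !linearDl /= (dotC dot y x); ring. Qed.

(** Cauchy-Schwarz comes from squaring the triangle inequality, which the norm of the space already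
    satisfies. *)
Lemma dot_le_norm (R : realType) (V : normedModType R)
    (dot : {dot V for idfun}) (hV : induces_norm dot) (x y : V) :
  dot x y <= `|x| * `|y|.
Proof.
have : `|x + y| ^+ 2 <= (`|x| + `|y|) ^+ 2.
  by rewrite lerXn2r ?nnegrE ?addr_ge0// ler_normD.
rewrite (sqr_normD hV); lra.
Qed.

(** On the segment from [x] to [y], convexity makes the gain from [f] and [l] at least linear in
    [t], while [q] costs only [t ^+ 2]. The quadratic term therefore drops out of the optimality
    condition as [t] tends to 0. *)
Lemma convex_first_order (R : realType) (V : lmodType R) (f : V -> \bar R)
    (l q : V -> R) (x : V) :
  convex_efun f -> (forall y, f y <> -oo%E) -> (f x < +oo)%E ->
  (forall t d, l (t *: d) = t * l d) ->
  (forall t d, q (t *: d) = t ^+ 2 * q d) ->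
  (forall y, (f x <= f y + (l (y - x) + q (y - x))%:E)%E) ->
  forall y, (f x <= f y + (l (y - x))%:E)%E.
Proof.
move=> cf fN fx lZ qZ fmin y.
case fxE : (f x) fx (fN x) => [a| |] // _ _.
case fyE : (f y) (fN y) => [b| |] // _; last by rewrite leey.
rewrite lee_fin leNgt; apply/negP => h.
set e := a - b - l (y - x); have e0 : 0 < e by rewrite /e; lra.
set d := y - x in e h e0.
(* This [t] replaces the limit: it lies in ]0, 1] and gives [t * q d < e], so [q] cannot make up for
   the assumed violation [e]. *)
pose t := e / (e + `|q d|).
have D0 : 0 < e + `|q d| by rewrite ltr_wpDr.
have t0 : 0 < t by rewrite divr_gt0.
have t1 : t <= 1 by rewrite ler_pdivrMr// mul1r lerDl.
have := fmin (t *: y + (1 - t) *: x).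
have -> : t *: y + (1 - t) *: x - x = t *: d.
  by rewrite scalerBl scale1r addrA addrAC addrK /d scalerBr.
move=> h1.
have := cf y x t; rewrite (ltW t0) t1 => /(_ isT) h2.
have := le_trans h1 (leeD h2 (lexx _)).
rewrite fxE fyE -!EFinM -!EFinD lee_fin lZ qZ => h3.
have : 0 <= t * (- e + t * q d).
  by rewrite /e -subr_ge0 in h3 *; move: h3; congr (_ <= _); ring.
rewrite pmulr_rge0// addrC subr_ge0 => h4.
have : t * q d < e.
  rewrite /t mulrAC ltr_pdivrMr// ltr_pM2l//.
  by apply: le_lt_trans (ler_norm _) _; rewrite ltrDr.
by rewrite ltNge h4.
Qed.

(** The representative is the minimizer of [J], whose first-order condition is [dot x v = f v];
    completeness provides the minimizer. *)
Lemma riesz_representation (R : realType) (V : completeNormedModType R)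
    (dot : {dot V for idfun}) (hV : induces_norm dot) (f : {scalar V}) (M : R) :
  (forall v, `|f v| <= M * `|v|) -> exists s : V, forall v, dot s v = f v.
Proof.
move=> fM.
have fZ t v : f (t *: v) = t * f v by exact: linearZ_LR.
have dZ t v w : dot v (t *: w) = t * dot v w by exact: linearZr_LR.
pose J (x : V) : R := `|x| ^+ 2 - 2 * f x.
have JD x d : J (x + d) = J x + (2 * dot x d - 2 * f d) + `|d| ^+ 2.
  rewrite /J (sqr_normD hV) linearD; ring.
have Jlow x : - M ^+ 2 <= J x.
  have := fM x; have := ler_norm (f x); have := sqr_ge0 (`|x| - M).
  rewrite /J; nra.
pose m := inf (range J).
have Jinf : has_inf (range J).
  by split; [exists (J 0), 0|exists (- M ^+ 2) => _ [x _ <-]].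
have Jm x : m <= J x by apply: ge_inf; [case: Jinf|exists x].
have Jadh e : 0 < e -> exists x, J x < m + e.
  by move=> e0; have [_ [x _ <-] ?] := inf_adherent e0 Jinf; exists x.
(* The parallelogram identity makes the diameter of the sublevel sets
   vanish. *)
have Jdist x y e : J x < m + e -> J y < m + e -> `|y - x| ^+ 2 < 4 * e.
  move=> hx hy; have := Jm (x + 2^-1 *: (y - x)).
  have := JD x (y - x); rewrite subrKC JD fZ dZ.
  rewrite normrZ exprMn (ger0_norm (x := 2^-1)) ?invr_ge0//.
  lra.
(* The filter generated by the sublevel sets of [J] takes the place of a minimizing sequence, so no
   choice of points is needed. *)
pose F := [set A : set V | exists2 e, 0 < e & [set x | J x < m + e] `<=` A].
have FF : ProperFilter F.
  split; last split.
  - by move=> [e e0 eA]; have [x /eA] := Jadh e e0.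
  - by exists 1.
  - move=> A A' [e e0 eA] [e' e'0 eA']; exists (Num.min e e').
      by rewrite lt_min e0.
    move=> x /= hx; split; [apply: eA|apply: eA'] => /=;
      by apply: lt_le_trans hx _; rewrite lerD2l ge_min lexx ?orbT.
  - by move=> A A' AA' [e e0 eA]; exists e => //; apply: subset_trans AA'.
have /cauchy_cvgP /cvg_ex[/= x Fx] : cauchy F.
  apply: cauchy_exP => e e0.
  have e20 : 0 < e ^+ 2 / 4 by rewrite divr_gt0// exprn_gt0.
  have [x hx] := Jadh _ e20; exists x, (e ^+ 2 / 4) => // y hy.
  rewrite -ball_normE /= distrC.
  rewrite -(@ltr_pXn2r _ 2)// ?nnegrE ?(ltW e0)//.
  have := Jdist _ _ _ hx hy; lra.
have Jx : J x <= m.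
  rewrite leNgt; apply/negP => mJx.
  set e := (J x - m) / 2; have e0 : 0 < e by rewrite /e; lra.
  (* [2 * (|x| + |M|)] bounds the slope in the linear part of [J] at [x], and the 1 keeps [K]
     positive. A point within [e / K] of [x] with [J] below [m + e] would give [J x < m + 2 * e],
     which is [J x] itself. *)
  pose K := 2 * (`|x| + `|M|) + 1.
  have K0 : 0 < K by rewrite ltr_wpDl// mulr_ge0// addr_ge0.
  have [e' e'0 /= he'] : F (ball x (e / K)).
    by apply: Fx; apply: nbhsx_ballx; rewrite divr_gt0.
  have [y hy] : exists y, J y < m + Num.min e e'.
    by apply: Jadh; rewrite lt_min e0.
  have hy' : J y < m + e'.
    by apply: lt_le_trans hy _; rewrite lerD2l ge_min lexx orbT.
  have {}hy : J y < m + e.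
    by apply: lt_le_trans hy _; rewrite lerD2l ge_min lexx.
  have := he' y hy'; rewrite -ball_normE /= ltr_pdivlMr// => hd.
  have := JD x (y - x); rewrite subrKC => JyE.
  have h1 := dot_le_norm hV x (x - y).
  have h2 : f (y - x) <= `|M| * `|x - y|.
    apply: le_trans (ler_norm _) _; apply: le_trans (fM _) _.
    by rewrite distrC ler_wpM2r// ler_norm.
  move: h1; rewrite -(opprB y x) linearNr/= normrN => h1.
  move: h2 hd; rewrite -(opprB y x) normrN => h2 hd.
  have := sqr_ge0 `|y - x|; have := normr_ge0 (y - x).
  move: hd; rewrite /K /e in hy *; lra.
(* [J] is all linear plus quadratic part around [x], so the convex function is taken to be 0.
   Applying the result to [- v] later gives the reverse inequality. *)
have le v : 0 <= dot x v - f v.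
  have : (0 <= 0 + (2 * dot x (x + v - x) - 2 * f (x + v - x))%:E)%E.
    apply: (@convex_first_order R V (fun=> 0%E)
      (fun d => 2 * dot x d - 2 * f d) (fun d => `|d| ^+ 2)) => //.
    - by move=> ? ? t _; rewrite !mule0 adde0.
    - by rewrite ltry.
    - by move=> t d; rewrite fZ dZ; ring.
    - by move=> t d; rewrite normrZ exprMn real_normK// num_real.
    - move=> y; rewrite add0e lee_fin.
      have := JD x (y - x); rewrite subrKC; have := Jm y; lra.
  rewrite (addrC x v) addrK.
  rewrite add0e lee_fin; lra.
exists x => v; apply/eqP; rewrite eq_le; apply/andP; split.
  have := le (- v); rewrite (linearN f) (linearNr dot)/=; lra.
by rewrite -subr_ge0.
Qed.

(** Provides [B^* y] for a single [y], which is all that the optimality condition for [u]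
    requires. *)
Lemma adjoint_apply (R : realType) (X Y : completeNormedModType R)
    (dotX : {dot X for idfun}) (dotY : {dot Y for idfun})
    (hX : induces_norm dotX) (hY : induces_norm dotY)
    (B : {linear X -> Y}) (B_bounded : bounded_near B (nbhs (0 : X))) (y : Y) :
  exists s : X, forall v, dotX s v = dotY y (B v).
Proof.
have [M BM] : exists M, forall v, `|B v| <= M * `|v|.
  have /linear_boundedP Bb := B_bounded.
  by have [M HM] := filter_ex Bb; exists M.
apply: (@riesz_representation _ _ _ hX (dotY y \o B) (`|y| * M)) => v /=.
have yB w : dotY y (B w) <= `|y| * M * `|w|.
  apply: le_trans (dot_le_norm hY _ _) _.
  by rewrite -mulrA ler_wpM2l.
rewrite ler_norml yB andbT lerNl -[X in X <= _](linearNr dotY) -linearN.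
by have := yB (- v); rewrite normrN.
Qed.

(** Adding the two strengthened subgradient inequalities cancels the values of [f], which is
    legitimate because they are finite. *)
Lemma symmetrization_le_dot (R : realType) (V : normedModType R)
    (dot : {dot V for idfun}) (f : V -> \bar R) (rho : V -> V -> R)
    (x x' s s' : V) :
  coercivity_functional dot f rho -> f x \is a fin_num -> f x' \is a fin_num ->
  subdifferential dot f x s -> subdifferential dot f x' s' ->
  symmetrization rho x x' <= dot (s' - s) (x' - x).
Proof.
move=> [_ hrho] /fineK fx /fineK fx' /hrho/(_ x') + /hrho/(_ x).
rewrite -fx -fx' -!EFinD !lee_fin /symmetrization.
rewrite -(opprB x' x) (linearNr dot) (linearBl dot)/=; lra.
Qed.

Lemma sqr_normB (R : realType) (V : normedModType R)
    (dot : {dot V for idfun}) (hV : induces_norm dot) (x y : V) :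
  `|x - y| ^+ 2 = `|x| ^+ 2 - 2 * dot x y + `|y| ^+ 2.
Proof. by rewrite (sqr_normD hV) (linearNr dot)/= normrN mulrN. Qed.

(** * Optimality conditions of the two ADMM subproblems *)

Section ADMM.
Context (R : realType) (X Y : completeNormedModType R).
Context (dotX : {dot X for idfun}) (dotY : {dot Y for idfun}).
Hypotheses (hX : induces_norm dotX) (hY : induces_norm dotY).
Context (F : Y -> \bar R) (G : X -> \bar R).
Hypotheses (F_convex : convex_efun F) (F_proper : proper_fun F).
Hypotheses (G_convex : convex_efun G) (G_proper : proper_fun G).
Context (B : {linear X -> Y}).
Hypothesis B_bounded : bounded_near B (nbhs (0 : X)).

Let L := aug_lagrangian dotY F G B.

Lemma aug_lagrangian_minimizer_p_lt_pinfty tau u p lambda :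
  (G u < +oo)%E -> is_minimizer (fun q => L tau u q lambda) p -> (F p < +oo)%E.
Proof.
move=> Gu pmin; have [FN [q Fq]] := F_proper; have := pmin q.
rewrite /L /aug_lagrangian ltey; apply: contraTneq => ->.
case: (G u) Gu (G_proper.1 u) => // g _ _.
by case: (F q) Fq (FN q) => // a _ _; rewrite -!EFinD leNgt ltry.
Qed.

Lemma aug_lagrangian_minimizer_u_lt_pinfty tau u p lambda :
  (F p < +oo)%E -> is_minimizer (fun v => L tau v p lambda) u -> (G u < +oo)%E.
Proof.
move=> Fp umin; have [GN [v Gv]] := G_proper; have := umin v.
rewrite /L /aug_lagrangian ltey; apply: contraTneq => ->.
case: (F p) Fp (F_proper.1 p) => // a _ _.
by case: (G v) Gv (GN v) => // g _ _; rewrite -!EFinD leNgt ltry.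
Qed.

(** Expanding the penalty around [p] leaves a linear term with slope [- mu] and a quadratic term
    that [convex_first_order] discards. In the iteration [u] is the previous iterate, so [mu] is not
    yet the new multiplier. *)
Lemma aug_lagrangian_minimizer_p_subgradient tau u p lambda :
  (G u < +oo)%E -> is_minimizer (fun q => L tau u q lambda) p ->
  subdifferential dotY F p (lambda + tau *: (B u - p)).
Proof.
move=> Gu pmin q; set mu := lambda + _.
have Fp := aug_lagrangian_minimizer_p_lt_pinfty Gu pmin.
have := @convex_first_order _ _ F (fun d => - dotY mu d)
  (fun d => tau / 2 * `|d| ^+ 2) p F_convex F_proper.1 Fp.
move=> /(_ _ _ _ q); rewrite EFinN leeBrDr// addeC; apply.
- by move=> t d; rewrite (linearZr_LR dotY)/= mulrN.
- by move=> t d; rewrite normrZ exprMn real_normK ?num_real//; ring.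
move=> {}q; have := pmin q; rewrite /L /aug_lagrangian.
have -> : B u - q = (B u - p) - (q - p) by rewrite opprB addrA subrK.
rewrite /mu; move: (B u - p) (q - p) => w d.
rewrite (sqr_normB hY) (linearBr dotY)/=.
rewrite (linearDl dotY)/= (linearZl_LR dotY)/=.
case: (G u) Gu (G_proper.1 u) => // g _ _.
case: (F p) Fp (F_proper.1 p) => // a _ _.
case: (F q) (F_proper.1 q) => [b| |]// _; last by move=> _; rewrite leey.
rewrite -!EFinD !lee_fin; lra.
Qed.

(** The same expansion around [u], with [s] standing for [- B^* mu]. Here [u] is the new iterate, so
    [mu] is exactly the updated multiplier. *)
Lemma aug_lagrangian_minimizer_u_subgradient tau u p lambda :
  (F p < +oo)%E -> is_minimizer (fun v => L tau v p lambda) u ->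
  exists2 s, subdifferential dotX G u s &
    forall v, dotX s v = - dotY (lambda + tau *: (B u - p)) (B v).
Proof.
move=> Fp umin; set mu := lambda + _.
have Gu := aug_lagrangian_minimizer_u_lt_pinfty Fp umin.
have [s sE] := adjoint_apply hX hY B_bounded (- mu).
exists s => v; last by rewrite sE (linearNl dotY).
have := @convex_first_order _ _ G (fun d => - dotX s d)
  (fun d => tau / 2 * `|B d| ^+ 2) u G_convex G_proper.1 Gu.
move=> /(_ _ _ _ v); rewrite EFinN leeBrDr// addeC; apply.
- by move=> t d; rewrite (linearZr_LR dotX)/= mulrN.
- move=> t d; rewrite linearZ/= normrZ exprMn real_normK ?num_real//; ring.
move=> {}v; have := umin v; rewrite /L /aug_lagrangian sE.
have -> : B v - p = (B u - p) + B (v - u).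
  by rewrite linearB [RHS]addrC subrKA.
rewrite /mu; move: (B u - p) (B (v - u)) => w d.
rewrite (sqr_normD hY) (linearDr dotY)/=.
rewrite (linearNl dotY)/= (linearDl dotY)/= (linearZl_LR dotY)/=.
case: (F p) Fp (F_proper.1 p) => // a _ _.
case: (G u) Gu (G_proper.1 u) => // g _ _.
case: (G v) (G_proper.1 v) => [b| |]// _; last by move=> _; rewrite leey.
rewrite -!EFinD !lee_fin; lra.
Qed.

End ADMM.

(* The defect of the inequality is
   [|(a - t b) - (r a' - s b')|^2 + (1 - r^2) |a'|^2] with [r = t / s]. *)
Lemma residual_decrease (R : realType) (V : normedModType R)
    (dot : {dot V for idfun}) (hV : induces_norm dot) (s t : R) (a a' b b' : V) :
  0 < t -> t <= s ->
  2 * t * (dot (a - t *: b + s *: b') (b - t^-1 *: a + s^-1 *: a') - dot a b)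
    + (`|a| ^+ 2 + t ^+ 2 * `|b| ^+ 2) <= `|a'| ^+ 2 + s ^+ 2 * `|b'| ^+ 2.
Proof.
move=> t0 ts; have s0 := lt_le_trans t0 ts.
pose r := t / s.
have r1 : 0 <= 1 - r ^+ 2.
  rewrite subr_ge0 expr_le1//; first by rewrite /r ler_pdivrMr ?mul1r.
  by rewrite divr_ge0 ?ltW.
have := addr_ge0 (sqr_ge0 `|(a - t *: b) - (r *: a' - s *: b')|)
  (mulr_ge0 r1 (sqr_ge0 `|a'|)).
rewrite -subr_ge0 => h; rewrite -subr_ge0; move: h; congr (0 <= _).
rewrite !hV.
rewrite !(linearDr dot, linearNr dot, linearZr_LR dot, linearDl dot,
  linearNl dot, linearZl_LR dot)/=.
rewrite (dotC dot b a) (dotC dot a' a) (dotC dot b' a) (dotC dot a' b)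
  (dotC dot b' b) (dotC dot b' a') /r.
field. by rewrite !gt_eqF.
Qed.

(** * Assembly of the estimate along the iteration *)

Unset Implicit Arguments.

Theorem proposition3p11 (R : realType) (X Y : completeNormedModType R)
    (dotX : {dot X for idfun}) (dotY : {dot Y for idfun})
    (hX : induces_norm dotX) (hY : induces_norm dotY)
    (F : Y -> \bar R) (G : X -> \bar R)
    (F_convex : convex_efun F) (F_proper : proper_fun F)
    (F_lsc : lower_semicontinuous F)
    (G_convex : convex_efun G) (G_proper : proper_fun G)
    (G_lsc : lower_semicontinuous G)
    (B : {linear X -> Y}) (B_bounded : bounded_near B (nbhs (0 : X)))
    (FBG_proper : proper_fun (fun v : X => (F (B v) + G v)%E))
    (FBG_coercive : coercive_fun (fun v : X => (F (B v) + G v)%E))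
    (has_saddle : exists t : R, 0 < t /\
       exists (us : X) (ps ls : Y), saddle_point dotY F G B t us ps ls)
    (rhoF : Y -> Y -> R) (rhoG : X -> X -> R)
    (hrhoF : coercivity_functional dotY F rhoF)
    (hrhoG : coercivity_functional dotX G rhoG)
    (tau_low tau_up : R)
    (u : nat -> X) (p lambda : nat -> Y) (tau : nat -> R)
    (hadmm : generalized_admm dotY F G B tau_low tau_up u p lambda tau) :
  forall j : nat, (1 <= j)%N -> tau j.+1 <= tau j ->
    2 * tau j.+1 * (symmetrization rhoF (p j) (p j.+1)
                    + symmetrization rhoG (u j) (u j.+1))
      + residual B u lambda tau j.+1 ^+ 2 <= residual B u lambda tau j ^+ 2
    /\ residual B u lambda tau j.+1 <= residual B u lambda tau j.
Proof.
have [Ginit low0 lowup tau1 pmin umin lamE tau_bd] := hadmm.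
have lamS k : lambda k.+1 = lambda k + tau k.+1 *: (B (u k.+1) - p k.+1).
  exact: lamE.
(* The bounds in [admm_tau] start at index 2; the first step size is [tau_up]. *)
have tau_gt0 k : 0 < tau k.+1.
  case: k => [|k]; first by rewrite tau1 (lt_le_trans low0).
  by have /andP[h _] := tau_bd k.+1 isT; apply: lt_le_trans h.
(* Finiteness passes alternately from [u k] to [p k.+1] and on to [u k.+1], starting from
   [admm_init]. *)
have Fp_of_Gu k : (G (u k) < +oo)%E -> (F (p k.+1) < +oo)%E.
  move=> Gu.
  exact: (aug_lagrangian_minimizer_p_lt_pinfty F_proper G_proper Gu (pmin k.+1 isT)).
have Gu k : (G (u k) < +oo)%E.
  elim: k => [//|k /Fp_of_Gu Fp].
  exact: (aug_lagrangian_minimizer_u_lt_pinfty F_proper G_proper Fp (umin k.+1 isT)).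
have Fp k : (F (p k.+1) < +oo)%E by exact: Fp_of_Gu.
have fin (T : Type) (f : T -> \bar R) x : proper_fun f -> (f x < +oo)%E ->
    f x \is a fin_num.
  by move=> [fN _] fx; rewrite fin_numE -ltey fx andbT; apply/eqP.
(* From here [j] is [i.+1], so the residuals compared involve the indices [i], [i.+1] and [i.+2]. *)
move=> [//|i] _ ts.
have t0 := tau_gt0 i.+1; have s0 := tau_gt0 i.
have rhoF_le : symmetrization rhoF (p i.+1) (p i.+2) <= dotY
    (lambda i.+1 + tau i.+2 *: (B (u i.+1) - p i.+2)
     - (lambda i + tau i.+1 *: (B (u i) - p i.+1))) (p i.+2 - p i.+1).
  have sub k := aug_lagrangian_minimizer_p_subgradient hY F_convex F_proper
    G_proper (Gu k) (pmin k.+1 isT).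
  exact: (symmetrization_le_dot hrhoF (fin _ _ _ F_proper (Fp _))
    (fin _ _ _ F_proper (Fp _)) (sub i) (sub i.+1)).
have rhoG_le : symmetrization rhoG (u i.+1) (u i.+2) <=
    - dotY (lambda i.+2 - lambda i.+1) (B (u i.+2 - u i.+1)).
  have [x sx xE] := aug_lagrangian_minimizer_u_subgradient hX hY
    F_proper G_convex G_proper B_bounded (Fp i) (umin i.+1 isT).
  have [y sy yE] := aug_lagrangian_minimizer_u_subgradient hX hY
    F_proper G_convex G_proper B_bounded (Fp i.+1) (umin i.+2 isT).
  have := symmetrization_le_dot hrhoG
    (fin _ _ _ G_proper (Gu _)) (fin _ _ _ G_proper (Gu _)) sx sy.
  rewrite (linearBl dotX)/= xE yE /= -!lamS (linearBl dotY)/=.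
  by rewrite opprB opprK addrC.
have R_ge0 k : 0 <= residual B u lambda tau k by exact: sqrtr_ge0.
have R_sqr k : residual B u lambda tau k ^+ 2 =
    `|lambda k - lambda k.-1| ^+ 2 + tau k ^+ 2 * `|B (u k - u k.-1)| ^+ 2.
  by rewrite sqr_sqrtr// addr_ge0// mulr_ge0// sqr_ge0.
(* With this and [muE], the bound [rhoF_le] involves only increments of [lambda] and of [B u]. *)
have pE k : p k.+1 = B (u k.+1) - (tau k.+1)^-1 *: (lambda k.+1 - lambda k).
  rewrite lamS addrAC subrr add0r scalerA mulVf ?gt_eqF ?scale1r//.
  by rewrite subKr.
have muE k : lambda k + tau k.+1 *: (B (u k) - p k.+1)
    = lambda k.+1 - tau k.+1 *: B (u k.+1 - u k).
  rewrite lamS (linearB B) -addrA -scalerBr (opprB (B (u k.+1)) (B (u k))).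
  by congr (_ + _ *: _); rewrite [RHS]addrC subrKA.
have subrBB (a b c d : Y) : (a - b) - (c - d) = a - c - b + d.
  by rewrite opprB addrA addrAC (addrAC a).
have decrease : 2 * tau i.+2 * (symmetrization rhoF (p i.+1) (p i.+2)
      + symmetrization rhoG (u i.+1) (u i.+2))
    + residual B u lambda tau i.+2 ^+ 2 <= residual B u lambda tau i.+1 ^+ 2.
  (* Here [s] is [tau i.+1] and [t] is [tau i.+2]. The term [- dot a b] absorbs the bound for [G],
     and the other inner product the bound for [F]. *)
  have := residual_decrease hY (lambda i.+2 - lambda i.+1)
    (lambda i.+1 - lambda i) (B (u i.+2 - u i.+1)) (B (u i.+1 - u i)) t0 ts.
  rewrite !R_sqr; apply: le_trans; rewrite lerD2r ler_pM2l ?mulr_gt0//.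
  apply: lerD rhoG_le; move: rhoF_le; rewrite !muE !pE !subrBB.
  by rewrite -(linearB B).
split=> //.
rewrite -(@ler_pXn2r _ 2)// ?nnegrE//; apply: le_trans decrease.
rewrite lerDr mulr_ge0 ?mulr_ge0 ?(ltW t0)//.
have [F0 _] := hrhoF; have [G0 _] := hrhoG.
by rewrite !addr_ge0.
Qed.
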